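(* Let $R$ be a ring with identity and let $A$ be a chain complex of (left) $R$-modules. Then $A$ is an absolutely clean chain complex if and only if $A$ is exact and, for every $n \in \mathbb{Z}$, the cycle module $Z_nA = \ker(A_n \to A_{n-1})$ is an absolutely clean $R$-module.
   Context: $R$-modules are left $R$-modules; $\mathrm{Ch}(R)$ is the category of ($\mathbb{Z}$-graded, unbounded) chain complexes of $R$-modules, with differentials lowering degree. A chain complex is finitely generated if it is bounded and finitely generated in each degree. An $R$-module $M$ is of type $FP_\infty$ if it has a projective resolution by finitely generated projective modules. A chain complex $X$ is of type $FP_\infty$ if it has a projective resolution $\cdots \to P_2 \to P_1 \to P_0 \to X \to 0$ in $\mathrm{Ch}(R)$ with each $P_i$ a finitely generated projective object of $\mathrm{Ch}(R)$. An $R$-module $N$ is absolutely clean if $\mathrm{Ext}^1_R(M,N)=0$ for all $R$-modules $M$ of type $FP_\infty$. A chain complex $A$ is absolutely clean if $\mathrm{Ext}^1_{\mathrm{Ch}(R)}(X,A)=0$ for all chain complexes $X$ of type $FP_\infty$. *)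

(* Defs.v *)
From HB Require Import structures.
From mathcomp Require Import all_boot all_algebra.

Set Implicit Arguments.
Unset Strict Implicit.
Unset Printing Implicit Defensive.

Import GRing.Theory.
Local Open Scope ring_scope.

(* [pzRingType] is the structure of unital, associative, not necessarily
   commutative (and possibly zero) rings; [lmodType R] are left R-modules. *)

Definition surj (U V : Type) (f : U -> V) : Prop := forall y, exists x, f x = y.

Definition exact_at (R : pzRingType) (U V W : lmodType R)
    (f : {linear U -> V}) (g : {linear V -> W}) : Prop :=
  forall y : V, g y = 0 <-> exists x : U, f x = y.

Section Kernel.
Variables (R : pzRingType) (U V : lmodType R) (f : {linear U -> V}).

Definition ker_pred : {pred U} := fun x => f x == 0.

Lemma ker_submod_closed : submod_closed ker_pred.
Proof.
split=> [|a x y]; rewrite !unfold_in ?linear0 // => /eqP fx /eqP fy.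
by rewrite linearP fx fy scaler0 addr0.
Qed.

HB.instance Definition _ :=
  GRing.isSubmodClosed.Build R U ker_pred ker_submod_closed.

Record ker : Type := Ker { ker_val : U; ker_valP : ker_val \in ker_pred }.

HB.instance Definition _ := [isSub for ker_val].
HB.instance Definition _ := [Choice of ker by <:].
HB.instance Definition _ := [SubChoice_isSubZmodule of ker by <:].
HB.instance Definition _ := [SubZmodule_isSubLmodule of ker by <:].

End Kernel.

Section Modules.
Variable R : pzRingType.
Implicit Types M N P : lmodType R.

Definition fin_gen M : Prop :=
  exists (n : nat) (v : 'I_n -> M),
    forall x : M, exists a : 'I_n -> R, x = \sum_(i < n) a i *: v i.

Definition projective P : Prop :=
  forall (M N : lmodType R) (g : {linear M -> N}) (f : {linear P -> N}),
    surj g -> exists h : {linear P -> M}, forall x, g (h x) = f x.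

Definition FP_infty M : Prop :=
  exists (P : nat -> lmodType R) (d : forall n, {linear P n.+1 -> P n})
         (e : {linear P 0%N -> M}),
    [/\ forall n, fin_gen (P n) /\ projective (P n),
        surj e,
        exact_at (d 0%N) e
      & forall n, exact_at (d n.+1) (d n)].

(* A short exact sequence 0 -> N -> E -> M -> 0. *)
Record extension M N : Type := Extension {
  ext_mid : lmodType R;
  ext_in : {linear N -> ext_mid};
  ext_out : {linear ext_mid -> M};
  ext_inj : injective ext_in;
  ext_surj : surj ext_out;
  ext_exact : exact_at ext_in ext_out }.

Definition ext_equiv M N (E F : extension M N) : Prop :=
  exists phi : {linear ext_mid E -> ext_mid F},
    [/\ bijective phi,
        forall y, phi (ext_in E y) = ext_in F y
      & forall x, ext_out F (phi x) = ext_out E x].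

End Modules.

Section DirectSum.
Variables (R : pzRingType) (M N : lmodType R).

Definition inl_fun (y : N) : N * M := (y, 0).
Definition outr_fun (z : N * M) : M := z.2.

Lemma inl_fun_linear : linear inl_fun.
Proof. by move=> a x y; congr pair; rewrite /= scaler0 addr0. Qed.

Lemma outr_fun_linear : linear outr_fun.
Proof. by []. Qed.

HB.instance Definition _ := GRing.isLinear.Build R N (N * M)%type _ inl_fun
  inl_fun_linear.
HB.instance Definition _ := GRing.isLinear.Build R (N * M)%type M _ outr_fun
  outr_fun_linear.

Definition inl_lin : {linear N -> (N * M)%type} := inl_fun.
Definition outr_lin : {linear (N * M)%type -> M} := outr_fun.

Lemma inl_lin_inj : injective inl_lin.
Proof. by move=> x y []. Qed.

Lemma outr_lin_surj : surj outr_lin.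
Proof. by move=> x; exists (0, x). Qed.

Lemma inl_outr_exact : exact_at inl_lin outr_lin.
Proof.
case=> y x; split; first by move=> /= ->; exists y.
by case=> y' [_ <-].
Qed.

Definition split_ext : extension M N :=
  Extension inl_lin_inj outr_lin_surj inl_outr_exact.

End DirectSum.

(* Ext^1_R(M,N) is the Yoneda group of equivalence classes of extensions of M
   by N under Baer sum; its zero element is the class of the split extension. *)
Definition Ext1_zero (R : pzRingType) (M N : lmodType R) : Prop :=
  forall E : extension M N, ext_equiv E (split_ext M N).

Definition abs_clean_mod (R : pzRingType) (N : lmodType R) : Prop :=
  forall M : lmodType R, FP_infty M -> Ext1_zero M N.

(* The differential X_{j+1} -> X_j is [dif X (j + 1) j]; indexing it by both
   source and target degrees, with junk value 0 when i <> j + 1, avoids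
   transports along equalities of degrees. *)
Record complex (R : pzRingType) : Type := Complex {
  deg : int -> lmodType R;
  dif : forall i j : int, {linear deg i -> deg j};
  dif_shape : forall i j, i <> j + 1 -> forall x, dif i j x = 0;
  dif_dif : forall i j k x, dif j k (dif i j x) = 0 }.

Coercion deg : complex >-> Funclass.

Record chain_map (R : pzRingType) (X Y : complex R) : Type := ChainMap {
  cmap : forall n, {linear X n -> Y n};
  cmap_dif : forall i j x, cmap j (dif X i j x) = dif Y i j (cmap i x) }.

Coercion cmap : chain_map >-> Funclass.

Section Complexes.
Variable R : pzRingType.
Implicit Types X Y A P : complex R.

Definition cycles X (n : int) : lmodType R := ker (dif X n (n - 1)).

Definition exact_complex X : Prop :=
  forall n : int, exact_at (dif X (n + 1) n) (dif X n (n - 1)).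

(* In Ch(R), monomorphisms, epimorphisms and exactness are degreewise. *)
Definition cinj X Y (f : chain_map X Y) : Prop := forall n, injective (f n).
Definition csurj X Y (f : chain_map X Y) : Prop := forall n, surj (f n).
Definition cexact_at X Y A (f : chain_map X Y) (g : chain_map Y A) : Prop :=
  forall n, exact_at (f n) (g n).

Definition bounded X : Prop :=
  exists a b : int, forall n : int, (n < a) || (b < n) -> forall x : X n, x = 0.

Definition cfin_gen X : Prop := bounded X /\ forall n, fin_gen (X n).

Definition cprojective P : Prop :=
  forall X Y (g : chain_map X Y) (f : chain_map P Y),
    csurj g -> exists h : chain_map P X, forall n x, g n (h n x) = f n x.

Definition cFP_infty X : Prop :=
  exists (P : nat -> complex R) (d : forall n, chain_map (P n.+1) (P n))
         (e : chain_map (P 0%N) X),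
    [/\ forall n, cfin_gen (P n) /\ cprojective (P n),
        csurj e,
        cexact_at (d 0%N) e
      & forall n, cexact_at (d n.+1) (d n)].

(* A short exact sequence 0 -> A -> E -> X -> 0 in Ch(R). *)
Record cextension X A : Type := CExtension {
  cext_mid : complex R;
  cext_in : chain_map A cext_mid;
  cext_out : chain_map cext_mid X;
  cext_inj : cinj cext_in;
  cext_surj : csurj cext_out;
  cext_exact : cexact_at cext_in cext_out }.

Definition cext_equiv X A (E F : cextension X A) : Prop :=
  exists phi : chain_map (cext_mid E) (cext_mid F),
    [/\ forall n, bijective (phi n),
        forall n y, phi n (cext_in E n y) = cext_in F n y
      & forall n x, cext_out F n (phi n x) = cext_out E n x].

End Complexes.

Section ComplexDirectSum.
Variables (R : pzRingType) (X A : complex R).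

Definition csum_dif_fun i j (z : A i * X i) : A j * X j :=
  (dif A i j z.1, dif X i j z.2).

Lemma csum_dif_linear i j : linear (@csum_dif_fun i j).
Proof. by move=> a x y; congr pair; rewrite /= linearP. Qed.

HB.instance Definition _ i j :=
  GRing.isLinear.Build R (A i * X i)%type (A j * X j)%type _
    (@csum_dif_fun i j) (@csum_dif_linear i j).

Definition csum_dif i j : {linear (A i * X i)%type -> (A j * X j)%type} :=
  @csum_dif_fun i j.

Lemma csum_dif_shape i j : i <> j + 1 -> forall z, csum_dif i j z = 0.
Proof. by move=> ij z; congr pair; rewrite /= dif_shape. Qed.

Lemma csum_dif_dif i j k z : csum_dif j k (csum_dif i j z) = 0.
Proof. by congr pair; rewrite /= dif_dif. Qed.

Definition csum : complex R :=
  @Complex R (fun n => (A n * X n)%type : lmodType R) csum_dif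
    csum_dif_shape csum_dif_dif.

Lemma cinl_dif i j x :
  inl_lin (X j) (A j) (dif A i j x) = dif csum i j (inl_lin (X i) (A i) x).
Proof. by congr pair; rewrite /= linear0. Qed.

Lemma coutr_dif i j z :
  outr_lin (X j) (A j) (dif csum i j z) = dif X i j (outr_lin (X i) (A i) z).
Proof. by []. Qed.

Definition cinl : chain_map A csum :=
  @ChainMap R A csum (fun n => inl_lin (X n) (A n)) cinl_dif.

Definition coutr : chain_map csum X :=
  @ChainMap R csum X (fun n => outr_lin (X n) (A n)) coutr_dif.

Definition csplit_ext : cextension X A :=
  @CExtension R X A csum cinl coutr
    (fun n => @inl_lin_inj R (X n) (A n)) (fun n => @outr_lin_surj R (X n) (A n))
    (fun n => @inl_outr_exact R (X n) (A n)).

End ComplexDirectSum.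

Definition cExt1_zero (R : pzRingType) (X A : complex R) : Prop :=
  forall E : cextension X A, cext_equiv E (csplit_ext X A).

Definition abs_clean_complex (R : pzRingType) (A : complex R) : Prop :=
  forall X : complex R, cFP_infty X -> cExt1_zero X A.

(* Main.v *)
Require Import Defs.
From mathcomp Require Import all_boot all_algebra.
From HB Require Import structures.
From mathcomp Require Import zify boolp.

(** If 0 -> A -> E -> X -> 0 is an extension with A exact, Z_n A absolutely
    clean and X of type FP_infty, then X is bounded, every X_n is of type
    FP_infty, and a section of E -> X is built degree by degree from below: the
    admissible values in degree n form an extension of X_n by Z_n A, which
    splits.

    Conversely a bounded complex of modules of type FP_infty is of type
    FP_infty: it is covered by a sum of disks on finitely generated projective
    modules, and the kernel of the cover is of the same kind. This applies to
    the spheres S^n(M) with M of type FP_infty. Splitting the extension of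
    S^(n+1)(R) by A given by the cone of a cycle y of degree n makes y a
    boundary; splitting the pushout along S^n(Z_n A) -> A of an extension
    0 -> Z_n A -> E -> M -> 0 placed in degree n splits the latter. *)

Set Implicit Arguments.
Unset Strict Implicit.
Unset Printing Implicit Defensive.

Import GRing.Theory.
Local Open Scope ring_scope.

(** * Linear maps *)

Section LinearMaps.
Variable R : pzRingType.
Implicit Types U V W : lmodType R.

Definition lin U V (f : U -> V) (f_lin : linear f) : {linear U -> V} :=
  HB.pack f (GRing.isLinear.Build R U V *:%R f f_lin).

(** Preimages under [f] are unique, so choosing them pointwise gives a linear map. *)
Lemma lin_mono_factor U V W (f : {linear U -> V}) (g : {linear W -> V}) :
  injective f -> (forall w, exists u, f u = g w) ->
  exists h : {linear W -> U}, forall w, f (h w) = g w.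
Proof.
move=> f_inj fg; have [h hP] := choice fg.
have h_lin : linear h by move=> a x y; apply: f_inj; rewrite linearP !hP linearP.
by exists (lin h_lin).
Qed.

(** Preimages under [p] of one point differ by an element of its kernel, which [g] kills, so [g]
    composed with any set-theoretic section of [p] is linear. *)
Lemma lin_epi_factor U V W (p : {linear U -> V}) (g : {linear U -> W}) :
  surj p -> (forall u, p u = 0 -> g u = 0) ->
  exists h : {linear V -> W}, forall u, h (p u) = g u.
Proof.
move=> p_surj pg; have [s sP] := choice p_surj.
have gE u v : p u = p v -> g u = g v.
  move=> puv; apply/eqP; rewrite -subr_eq0 -linearB; apply/eqP/pg.
  by rewrite linearB puv subrr.
have h_lin : linear (g \o s).
  by move=> a x y /=; rewrite -linearP; apply: gE; rewrite linearP !sP.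
by exists (lin h_lin) => u /=; apply: gE.
Qed.

Section KernelLift.
Variables (U V W : lmodType R) (f : {linear V -> W}) (h : {linear U -> V}).
Hypothesis fh0 : forall u, f (h u) = 0.

Fact ker_lift_subproof u : h u \in ker_pred f.
Proof. by apply/eqP/fh0. Qed.

Definition ker_lift_fun u : ker f := Ker (ker_lift_subproof u).

Fact ker_lift_linear : linear ker_lift_fun.
Proof. by move=> a x y; apply: val_inj; rewrite /= !linearP. Qed.

Definition ker_lift : {linear U -> ker f} := lin ker_lift_linear.

End KernelLift.

Lemma ker_eq0 U V (f : {linear U -> V}) (x : ker f) : f (ker_val x) = 0.
Proof. by apply/eqP; apply: (ker_valP x). Qed.

Lemma ker_val_linear U V (f : {linear U -> V}) : linear (@ker_val R U V f).
Proof. by []. Qed.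

Definition ker_in U V (f : {linear U -> V}) : {linear ker f -> U} :=
  lin (@ker_val_linear U V f).

Lemma ker_in_inj U V (f : {linear U -> V}) : injective (ker_in f).
Proof. exact: val_inj. Qed.

Lemma ker_in_exact U V (f : {linear U -> V}) : exact_at (ker_in f) f.
Proof.
move=> y; split=> [fy0|[x <-]]; last exact: ker_eq0.
by have yP : y \in ker_pred f by [apply/eqP]; exists (Ker yP).
Qed.

(* The identity when [i = j], and zero otherwise: it replaces the transport
   along an equality of degrees. *)
Definition idm (Q : int -> lmodType R) i j : {linear Q i -> Q j} :=
  match i =P j with
  | ReflectT e => ecast k {linear Q i -> Q k} e idfun
  | ReflectF _ => \0
  end.

Lemma idm_id Q i x : idm Q i i x = x.
Proof. by rewrite /idm; case: eqP => // e; rewrite (eq_irrelevance e (erefl i)). Qed.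

Lemma idm_neq Q i j x : i <> j -> idm Q i j x = 0.
Proof. by rewrite /idm; case: eqP. Qed.

End LinearMaps.

(** * Split extensions and sections *)

Section Extensions.
Variable R : pzRingType.

(** The inverse of an equivalence, restricted to the pairs [(0, x)], is a section. Given a section
    [s], each [e - s (ext_out E e)] comes from [N]; this defines a retraction [r], and
    [(r, ext_out E)] is an equivalence. *)
Lemma ext_splitP (M N : lmodType R) (E : extension M N) :
  ext_equiv E (split_ext M N) <->
  exists s : {linear M -> ext_mid E}, forall x, ext_out E (s x) = x.
Proof.
split=> [[phi [[psi psiK phiK] phi_in phi_out]]|[s sK]].
  have s_lin : linear (fun x => psi (0, x)).
    move=> a x y; apply: (can_inj psiK); rewrite linearP !phiK.
    by congr pair; rewrite /= ?scaler0 ?addr0.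
  by exists (lin s_lin) => x /=; rewrite -phi_out phiK.
have [|r rP] := @lin_mono_factor R _ _ _ (ext_in E)
    (idfun \- (s \o ext_out E)) (@ext_inj _ _ _ E).
  by move=> e /=; apply/ext_exact; rewrite linearB sK subrr.
have phi_lin : linear (fun e => (r e, ext_out E e)).
  by move=> a x y; rewrite !linearP.
have inK y : r (ext_in E y) = y.
  apply: (@ext_inj _ _ _ E); rewrite rP /=.
  have /= -> : ext_out E (ext_in E y) = 0 by apply/ext_exact; exists y.
  by rewrite linear0 subr0.
exists (lin phi_lin); split=> //=; last first.
  by move=> y; rewrite inK; congr pair; apply/ext_exact; exists y.
exists (fun z => ext_in E z.1 + s z.2) => [e|[y x]] /=.
  by rewrite rP /= subrK.
have out_in : ext_out E (ext_in E y) = 0 by apply/ext_exact; exists y.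
rewrite !linearD out_in sK add0r; congr pair.
rewrite inK; apply: (@ext_inj _ _ _ E).
by rewrite linearD rP /= sK subrr addr0.
Qed.

(** The same argument in each degree. The sections and retractions commute with the differentials
    because an injective chain map composed with them does. *)
Lemma cext_splitP (X A : complex R) (E : cextension X A) :
  cext_equiv E (csplit_ext X A) <->
  exists s : chain_map X (cext_mid E), forall n x, cext_out E n (s n x) = x.
Proof.
split=> [[phi [phi_bij phi_in phi_out]]|[s sK]].
  have sP n : exists s : {linear X n -> cext_mid E n},
      forall x, phi n (s x) = (0, x).
    have l_lin : linear (fun x : X n => (0, x) : csum X A n).
      by move=> a x y; congr pair; rewrite /= ?scaler0 ?addr0.
    apply: (lin_mono_factor (f := phi n) (g := lin l_lin)).
      exact: bij_inj (phi_bij n).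
    by case: (phi_bij n) => psi _ phiK w; exists (psi (lin l_lin w)).
  pose s n := projT1 (cid (sP n)).
  have sE n x : phi n (s n x) = (0, x) by apply: (projT2 (cid (sP n))).
  have s_dif i j x : s j (dif X i j x) = dif (cext_mid E) i j (s i x).
    apply: (bij_inj (phi_bij j)); rewrite sE cmap_dif sE.
    by congr pair; rewrite /= linear0.
  by exists (ChainMap s_dif) => n x /=; rewrite -phi_out sE.
have out_in n y : cext_out E n (cext_in E n y) = 0.
  by apply/cext_exact; exists y.
have rP n : exists r : {linear cext_mid E n -> A n},
    forall e, cext_in E n (r e) = e - s n (cext_out E n e).
  apply: (lin_mono_factor (f := cext_in E n)
           (g := idfun \- (s n \o cext_out E n)) (@cext_inj _ _ _ E n)).
  by move=> e /=; apply/cext_exact; rewrite linearB sK subrr.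
pose r n := projT1 (cid (rP n)).
have rE n e : cext_in E n (r n e) = e - s n (cext_out E n e).
  exact: (projT2 (cid (rP n))).
have r_dif i j e : r j (dif (cext_mid E) i j e) = dif A i j (r i e).
  apply: (@cext_inj _ _ _ E j); rewrite cmap_dif !rE linearB.
  by rewrite cmap_dif cmap_dif.
have phi_lin n : linear (fun e => (r n e, cext_out E n e) : csum X A n).
  by move=> a x y; rewrite !linearP.
have phi_dif i j e : lin (phi_lin j) (dif (cext_mid E) i j e) =
    dif (csum X A) i j (lin (phi_lin i) e).
  by congr pair; rewrite /= ?r_dif ?cmap_dif.
have inK n y : r n (cext_in E n y) = y.
  by apply: (@cext_inj _ _ _ E n); rewrite rE out_in linear0 subr0.
exists (ChainMap phi_dif); split=> //= [n|n y]; last first.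
  by rewrite inK out_in.
exists (fun z => cext_in E n z.1 + s n z.2) => [e|[y x]] /=.
  by rewrite rE subrK.
rewrite !linearD out_in sK add0r; congr pair.
by rewrite inK; apply: (@cext_inj _ _ _ E n); rewrite linearD rE sK subrr addr0.
Qed.

End Extensions.

(** * Modules of type FP_infty *)

Section FPModules.
Variable R : pzRingType.
Implicit Types M N P Q : lmodType R.

Lemma fin_gen_prod M N : fin_gen M -> fin_gen N -> fin_gen (M * N)%type.
Proof.
case=> m [v vP] [n [w wP]]; exists (m + n)%N.
exists (fun i => match split i with inl j => (v j, 0) | inr j => (0, w j) end).
case=> x y; have [[a ->] [b ->]] := (vP x, wP y).
exists (fun i => match split i with inl j => a j | inr j => b j end).
rewrite big_split_ord /=.
rewrite (eq_bigr (fun i => inl_lin N M (a i *: v i))); last first.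
  by move=> i _; rewrite -[lshift _ _]/(unsplit (inl i)) unsplitK linearZ.
rewrite -linear_sum [X in _ + X](eq_bigr (fun i => (0, b i *: w i) : M * N)); last first.
  by move=> i _; rewrite -[rshift _ _]/(unsplit (inr i)) unsplitK; congr pair; rewrite /= scaler0.
have r_lin : linear (fun y : N => (0, y) : (M * N)%type).
  by move=> c x' y'; congr pair; rewrite /= ?scaler0 ?addr0.
by rewrite -(linear_sum (lin r_lin)); apply: injective_projections => /=;
  rewrite (addr0, add0r).
Qed.

Lemma fin_gen_zero M : (forall x : M, x = 0) -> fin_gen M.
Proof.
by move=> M0; exists 0%N, (fun=> 0) => x; exists (fun=> 0); rewrite big_ord0.
Qed.

Lemma projective_zero P : (forall x : P, x = 0) -> projective P.
Proof. by move=> P0 M N g f _; exists \0 => x; rewrite (P0 x) !linear0. Qed.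

Lemma fin_gen_regular : fin_gen R^o.
Proof.
exists 1%N, (fun=> 1) => x; exists (fun=> x); rewrite big_ord1.
exact/esym/mulr1.
Qed.

Lemma projective_regular : projective R^o.
Proof.
move=> M N g f g_surj; have [y gy] := g_surj (f 1).
have h_lin : linear (fun a : R^o => a *: y).
  by move=> a b c; rewrite scalerDl scalerA.
by exists (lin h_lin) => a /=; rewrite linearZ gy -linearZ /= [_ *: _]mulr1.
Qed.

Lemma projective_prod P Q :
  projective P -> projective Q -> projective (P * Q)%type.
Proof.
move=> projP projQ M N g f g_surj.
have l_lin : linear (fun x : P => f (x, 0)).
  move=> a x y; rewrite -linearP; congr (f _).
  by congr pair; rewrite /= scaler0 addr0.
have r_lin : linear (fun y : Q => f (0, y)).
  move=> a x y; rewrite -linearP; congr (f _).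
  by congr pair; rewrite /= scaler0 addr0.
have [[h hP] [k kP]] := (projP _ _ g (lin l_lin) g_surj, projQ _ _ g (lin r_lin) g_surj).
have hk_lin : linear (fun z : P * Q => h z.1 + k z.2).
  by move=> a x y; rewrite !linearP scalerDr addrACA.
exists (lin hk_lin) => -[x y] /=; rewrite linearD hP kP /= -linearD.
by congr (f _); congr pair; rewrite /= ?addr0 ?add0r.
Qed.

(** The resolution is [P] in degree 0 and the zero module ['rV[R]_0] above. *)
Lemma FP_infty_projective P : fin_gen P -> projective P -> FP_infty P.
Proof.
move=> fgP projP.
exists (fun n => if n is 0%N then P else 'rV[R]_0).
exists (fun n => \0), idfun; split.
- have zero_unique (x : 'rV[R]_0) : x = 0 by rewrite [x]thinmx0.
  case=> [|n] //; split; first exact: fin_gen_zero.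
  exact: projective_zero.
- by move=> x; exists x.
- by move=> x; split=> [x0|[_ <-]] //; exists 0; apply: esym.
- by move=> n y; split=> // _; exists 0; rewrite [y]thinmx0.
Qed.

Lemma FP_infty_zero M : (forall x : M, x = 0) -> FP_infty M.
Proof.
by move=> M0; apply: FP_infty_projective; [apply: fin_gen_zero|apply: projective_zero].
Qed.

Lemma FP_infty_bij M N (f : {linear M -> N}) :
  injective f -> surj f -> FP_infty M -> FP_infty N.
Proof.
move=> f_inj f_surj [P [d [e [PP e_surj de dd]]]].
exists P, d, (f \o e); split=> //.
  by move=> y; have [x <-] := f_surj y; have [z <-] := e_surj x; exists z.
move=> y; split=> [/= fey|/de ey]; last by rewrite /= ey linear0.
by apply/de/f_inj; rewrite fey linear0.
Qed.

Lemma FP_infty_prod M N : FP_infty M -> FP_infty N -> FP_infty (M * N)%type.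
Proof.
move=> [P [d [e [PP e_surj de dd]]]] [P' [d' [e' [PP' e_surj' de' dd']]]].
have pair_lin (U V U' V' : lmodType R) (f : {linear U -> V}) (g : {linear U' -> V'}) :
    linear (fun z : U * U' => (f z.1, g z.2) : (V * V')%type).
  by move=> a x y; rewrite !linearP.
have pair_exact (U V W U' V' W' : lmodType R) (f : {linear U -> V}) (g : {linear V -> W})
    (f' : {linear U' -> V'}) (g' : {linear V' -> W'}) :
    exact_at f g -> exact_at f' g' ->
    exact_at (lin (@pair_lin _ _ _ _ f f')) (lin (@pair_lin _ _ _ _ g g')).
  move=> fg fg' [y y']; split=> /= [[/fg[x <-] /fg'[x' <-]]|[[x x'] [<- <-]]].
    by exists (x, x').
  by congr pair; [apply/fg; exists x|apply/fg'; exists x'].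
exists (fun n => P n * P' n)%type, (fun n => lin (@pair_lin _ _ _ _ (d n) (d' n))).
exists (lin (@pair_lin _ _ _ _ e e')); split.
- move=> n; have [[? ?] [? ?]] := (PP n, PP' n).
  by split; [apply: fin_gen_prod|apply: projective_prod].
- move=> [y y']; have [[x <-] [x' <-]] := (e_surj y, e_surj' y').
  by exists (x, x').
- exact: pair_exact.
- by move=> n; apply: pair_exact.
Qed.

(** The first term of a resolution covers [M], and the remaining terms resolve the kernel. The last
    clause serves to keep sums of disks on such covers bounded. *)
Lemma FP_infty_cover M : FP_infty M ->
  exists (Q : lmodType R) (q : {linear Q -> M}),
    [/\ fin_gen Q /\ projective Q, surj q, FP_infty (ker q)
      & (forall x : M, x = 0) -> forall y : Q, y = 0].
Proof.
move=> [P [d [e [PP e_surj de dd]]]].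
(* The first term of a resolution of the zero module may be nonzero, so this case takes the zero
   cover instead. *)
have [M0|Mn0] := pselect (forall x : M, x = 0).
  have zero_unique (x : 'rV[R]_0) : x = 0 by rewrite [x]thinmx0.
  exists 'rV[R]_0, \0; split=> // [|x|].
  - by split; [apply: fin_gen_zero|apply: projective_zero].
  - by exists 0; rewrite (M0 x).
  - by apply: FP_infty_zero => x; apply: val_inj; apply: zero_unique.
exists (P 0%N), e; split=> //.
have ed0 x : e (d 0%N x) = 0 by apply/de; exists x.
exists (fun n => P n.+1), (fun n => d n.+1), (ker_lift ed0); split=> //.
  by move=> [y yP]; have /de[x xy] := ker_eq0 (Ker yP); exists x; apply: val_inj.
move=> x; split=> [/(congr1 val)/= /(dd 0%N)//|/(dd 0%N) dx].
by apply: val_inj.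
Qed.

End FPModules.

(** * Complexes of type FP_infty *)

Section ChainMaps.
Variable R : pzRingType.
Implicit Types X Y P : complex R.

Fact ccomp_subproof X Y P (g : chain_map Y P) (f : chain_map X Y) i j x :
  (g j \o f j) (dif X i j x) = dif P i j ((g i \o f i) x).
Proof. by rewrite /= !cmap_dif. Qed.

Definition ccomp X Y P (g : chain_map Y P) (f : chain_map X Y) : chain_map X P :=
  @ChainMap R X P (fun n => g n \o f n) (ccomp_subproof g f).

Section KernelComplex.
Variables (X Y : complex R) (e : chain_map X Y).

Fact kercx_subproof i j (x : ker (e i)) : e j ((dif X i j \o ker_in (e i)) x) = 0.
Proof. by rewrite /= cmap_dif ker_eq0 linear0. Qed.

Definition kercx_dif i j : {linear ker (e i) -> ker (e j)} :=
  ker_lift (@kercx_subproof i j).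

Fact kercx_shape i j : i <> j + 1 -> forall x, kercx_dif i j x = 0.
Proof. by move=> ij x; apply: val_inj; rewrite /= dif_shape. Qed.

Fact kercx_dif_dif i j k x : kercx_dif j k (kercx_dif i j x) = 0.
Proof. by apply: val_inj; rewrite /= dif_dif. Qed.

Definition kercx : complex R :=
  @Complex R (fun n => ker (e n)) kercx_dif kercx_shape kercx_dif_dif.

Definition kercx_in : chain_map kercx X :=
  @ChainMap R kercx X (fun n => ker_in (e n)) (fun _ _ _ => erefl).

End KernelComplex.

End ChainMaps.

(** * Sums of disks and resolutions of bounded complexes *)

Section DiskSums.
Variable R : pzRingType.

(* The direct sum over k of the disks D^k(Q_k): the first summand in degree k
   is mapped identically onto the second one in degree k - 1. *)
Section DiskSum.
Variable Q : int -> lmodType R.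

Fact disk_linear i j :
  linear (fun z : Q i * Q (i + 1) => (0, idm Q i (j + 1) z.1) : Q j * Q (j + 1)).
Proof. by move=> a x y; congr pair; rewrite /= ?scaler0 ?addr0 ?linearP. Qed.

Fact disk_shape i j : i <> j + 1 -> forall z, lin (@disk_linear i j) z = 0.
Proof. by move=> ij z /=; rewrite idm_neq. Qed.

Fact disk_dif_dif i j k z : lin (@disk_linear j k) (lin (@disk_linear i j) z) = 0.
Proof. by rewrite /= linear0. Qed.

Definition disk : complex R :=
  @Complex R (fun k => (Q k * Q (k + 1))%type : lmodType R)
    (fun i j => lin (@disk_linear i j)) disk_shape disk_dif_dif.

Lemma cfin_gen_disk : (forall k, fin_gen (Q k)) ->
    (exists a b : int, forall k : int, (k < a) || (b < k) -> forall x : Q k, x = 0) ->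
  cfin_gen disk.
Proof.
move=> Q_fg [a [b Q0]]; split; last by move=> n; apply: fin_gen_prod.
(* Degree [n] also contains [Q (n + 1)], so the lower bound drops by one. *)
exists (a - 1), b => n nab [x y]; congr pair; apply: Q0.
  by case/orP: nab => h; apply/orP; [left|right]; lia.
by case/orP: nab => h; apply/orP; [left|right]; lia.
Qed.

Section FromDisk.
Variables (X : complex R) (q : forall k, {linear Q k -> X k}).

(** A chain map out of the disks is free on the first summands [Q k]; on the second summand
    [Q (k + 1)] it must be the differential of its value in degree [k + 1]. *)
Fact from_disk_linear k :
  linear (fun z : Q k * Q (k + 1) => q k z.1 + dif X (k + 1) k (q (k + 1) z.2)).
Proof. by move=> a x y; rewrite !linearP scalerDr addrACA. Qed.

Fact from_disk_dif i j (z : disk i) :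
  lin (@from_disk_linear j) (dif disk i j z) = dif X i j (lin (@from_disk_linear i) z).
Proof.
rewrite /= linear0 add0r linearD dif_dif addr0.
have [ij|ij] := pselect (i = j + 1); first by subst i; rewrite idm_id.
by rewrite idm_neq // (dif_shape ij) !linear0.
Qed.

Definition from_disk : chain_map disk X := ChainMap from_disk_dif.

End FromDisk.

Lemma cprojective_disk : (forall k, projective (Q k)) -> cprojective disk.
Proof.
move=> projQ X Y g f g_surj.
have l_lin k : linear (fun x : Q k => f k (x, 0)).
  move=> a x y; rewrite -linearP; congr (f k _).
  by congr pair; rewrite /= scaler0 addr0.
have hP k := projQ k _ _ (g k) (lin (l_lin k)) (g_surj k).
pose h k := projT1 (cid (hP k)).
have hE k x : g k (h k x) = f k (x, 0) by apply: (projT2 (cid (hP k))).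
exists (from_disk h) => n [x y] /=.
(* In degree [n], the element [(0, y)] is the differential of [(y, 0)] in degree [n + 1]. *)
rewrite linearD hE cmap_dif hE -cmap_dif -linearD; congr (f n _).
by congr pair; rewrite /= ?addr0 // idm_id add0r.
Qed.

End DiskSum.

Lemma idm_const (M : lmodType R) i j x : i = j -> idm (fun=> M) i j x = x.
Proof. by move=> ->; rewrite idm_id. Qed.

Lemma idm_const_map (M N : lmodType R) (g : {linear M -> N}) i j x :
  g (idm (fun=> M) i j x) = idm (fun=> N) i j (g x).
Proof.
have [ij|ij] := pselect (i = j); first by subst j; rewrite !idm_id.
by rewrite !idm_neq // linear0.
Qed.

Section DiskMap.
Variables (M N : lmodType R) (g : {linear M -> N}).

Fact disk_map_linear (k : int) : linear (fun z : disk (fun=> M) k =>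
  (g z.1, g z.2) : disk (fun=> N) k).
Proof. by move=> a x y; rewrite !linearP. Qed.

Fact disk_map_dif i j z : lin (@disk_map_linear j) (dif (disk (fun=> M)) i j z) =
  dif (disk (fun=> N)) i j (lin (@disk_map_linear i) z).
Proof. by congr pair; rewrite /= ?linear0 ?idm_const_map. Qed.

Definition disk_map : chain_map (disk (fun=> M)) (disk (fun=> N)) :=
  ChainMap disk_map_dif.

End DiskMap.

Section ToDisk.
Variables (X : complex R) (M : lmodType R) (f : forall k, {linear X k -> M}).

(** The second component is free; since the disk differential moves the first component to the
    second, the first one is forced. *)
Fact to_disk_linear k : linear (fun x : X k =>
  (f (k - 1) (dif X k (k - 1) x), f k x) : disk (fun=> M) k).
Proof. by move=> a x y; rewrite !linearP. Qed.

Fact to_disk_dif i j x : lin (@to_disk_linear j) (dif X i j x) =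
  dif (disk (fun=> M)) i j (lin (@to_disk_linear i) x).
Proof.
congr pair; rewrite /= ?dif_dif ?linear0 //.
have [ij|ij] := pselect (i = j + 1); last by rewrite dif_shape // idm_neq // linear0.
have -> : j = i - 1 by rewrite ij addrK.
by rewrite idm_const // subrK.
Qed.

Definition to_disk : chain_map X (disk (fun=> M)) := ChainMap to_disk_dif.

End ToDisk.

(* A chain map from P to the sum of all disks on M is the same as an arbitrary
   family of linear maps P_k -> M. *)
Lemma cprojective_deg (P : complex R) n : cprojective P -> projective (P n).
Proof.
move=> projP M N g f g_surj.
(* The family is [f] in degree [n] and zero elsewhere; the second component of the lift in degree
   [n] then lifts [f]. *)
have [] := projP _ _ (disk_map g) (to_disk (fun k => f \o idm P k n)).
  by move=> k [x y]; have [[x' <-] [y' <-]] := (g_surj x, g_surj y); exists (x', y').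
move=> h hP; exists (outr_lin M M \o h n) => x.
by have /(congr1 snd) /= := hP n x; rewrite idm_id.
Qed.

Lemma cFP_infty_bounded (X : complex R) : cFP_infty X -> bounded X.
Proof.
move=> [P [d [e [PP e_surj _ _]]]]; have [[[a [b P0]] _] _] := PP 0%N.
exists a, b => n nab x; have [y <-] := e_surj n x.
by rewrite (P0 n nab y) linear0.
Qed.

Lemma cFP_infty_deg (X : complex R) n : cFP_infty X -> FP_infty (X n).
Proof.
move=> [P [d [e [PP e_surj de dd]]]].
exists (fun k => P k n), (fun k => d k n), (e n); split=> [k||//|k].
- by have [[_ fgP] projP] := PP k; split=> //; apply: cprojective_deg.
- exact: e_surj.
- exact: dd.
Qed.

(** In degree [n] the kernel consists of the [(x, y)] with [q x + d (q y) = 0]. As [Q (n + 1)] is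
    projective, [d \o q] lifts through [q n] to some [t], and [(x, y) |-> (x + t y, y)] identifies
    the kernel with [ker (q n) * Q (n + 1)]. *)
Lemma cFP_infty_cover (X : complex R) :
    bounded X -> (forall n, FP_infty (X n)) ->
  exists (P : complex R) (e : chain_map P X),
    [/\ cfin_gen P, cprojective P, csurj e, bounded (kercx e)
      & forall n, FP_infty (kercx e n)].
Proof.
move=> [a [b X0]] FPX.
have QP k := cid (FP_infty_cover (FPX k)).
pose Q k := projT1 (QP k); pose q k := projT1 (cid (projT2 (QP k))).
have QE k : [/\ fin_gen (Q k) /\ projective (Q k), surj (q k), FP_infty (ker (q k))
      & (forall x : X k, x = 0) -> forall y : Q k, y = 0].
  exact: (projT2 (cid (projT2 (QP k)))).
have fgD : cfin_gen (disk Q).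
  apply: cfin_gen_disk => [k|]; first by have [[]] := QE k.
  by exists a, b => k kab; have [_ _ _] := QE k; apply; apply: X0.
exists (disk Q), (from_disk q); split.
- exact: fgD.
- by apply: cprojective_disk => k; have [[]] := QE k.
- move=> k x; have [_ q_surj _ _] := QE k; have [y <-] := q_surj x.
  by exists (y, 0); rewrite /= !linear0 addr0.
- have [[a' [b' P0]] _] := fgD.
  by exists a', b' => n nab x; apply: val_inj; apply: P0.
move=> n; have [_ q_surj FPker _] := QE n.
have [[fgQ projQ] _ _ _] := QE (n + 1).
have [t tP] := projQ _ _ (q n) (dif X (n + 1) n \o q (n + 1)) q_surj.
have h_lin : linear (fun z : ker (q n) * Q (n + 1) =>
    (ker_val z.1 - t z.2, z.2) : disk Q n).
  move=> c x y; congr pair; rewrite /= linearP -[ker_val _]/(ker_in (q n) _).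
  by rewrite linearP scalerDr addrACA.
have h0 z : from_disk q n (lin h_lin z) = 0.
  by rewrite /= linearB ker_eq0 tP sub0r addNr.
apply: (FP_infty_bij (f := ker_lift h0)).
- move=> [x y] [x' y'] /(congr1 val)/= [/[swap] -> /addIr xx'].
  by congr pair; apply: val_inj.
- move=> [[x y] xyP]; have xy0 := ker_eq0 (Ker xyP).
  have xP : x + t y \in ker_pred (q n).
    by apply/eqP; rewrite linearD tP.
  by exists (Ker xP, y); apply: val_inj; rewrite /= addrK.
- by apply: FP_infty_prod => //; apply: FP_infty_projective.
Qed.

(** The kernel of a cover satisfies both hypotheses again, hence lies in [G]. Iterating [next] gives
    the successive syzygies [S n], and their covers form the resolution. *)
Lemma cFP_infty_of_deg (X : complex R) :
  bounded X -> (forall n, FP_infty (X n)) -> cFP_infty X.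
Proof.
move=> bdX FPX.
pose G := {Y : complex R | bounded Y /\ forall n, FP_infty (Y n)}.
have cover (Y : G) := cid (cFP_infty_cover (projT2 Y).1 (projT2 Y).2).
pose P Y := projT1 (cover Y).
pose e Y : chain_map (P Y) (projT1 Y) := projT1 (cid (projT2 (cover Y))).
have eP Y : [/\ cfin_gen (P Y), cprojective (P Y), csurj (e Y), bounded (kercx (e Y))
      & forall n, FP_infty (kercx (e Y) n)].
  exact: (projT2 (cid (projT2 (cover Y)))).
have kerG Y : bounded (kercx (e Y)) /\ forall n, FP_infty (kercx (e Y) n).
  by have [] := eP Y.
pose next Y : G := exist _ (kercx (e Y)) (kerG Y).
pose S n := iter n next (exist _ X (conj bdX FPX)).
pose d n : chain_map (P (S n.+1)) (P (S n)) := ccomp (kercx_in (e (S n))) (e (S n.+1)).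
have d_exact n : cexact_at (d n) (e (S n)).
  move=> k y; split=> [ey0|[x <-]]; last exact: ker_eq0.
  have [x xy] := (ker_in_exact (e (S n) k) y).1 ey0.
  have [_ _ e_surj _ _] := eP (S n.+1).
  by have [z zx] := e_surj k x; exists z; rewrite -xy -zx.
exists (fun n => P (S n)), d, (e (S 0%N)); split.
- by move=> n; have [] := eP (S n).
- by have [] := eP (S 0%N).
- exact: d_exact.
move=> n k y; split=> [dy0|/d_exact ey0]; last first.
  by rewrite -[LHS]/(ker_in (e (S n) k) (e (S n.+1) k y)) ey0 linear0.
by apply/d_exact/(@ker_in_inj _ _ _ (e (S n) k)); rewrite linear0; exact: dy0.
Qed.

End DiskSums.

(** * Exact complexes with absolutely clean cycles *)

(** Stating the degrees through equations avoids transports between equal degrees. *)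
Lemma exact_complexE (R : pzRingType) (A : complex R) i j k :
  exact_complex A -> i = j + 1 -> k = j - 1 -> exact_at (dif A i j) (dif A j k).
Proof. by move=> A_exact -> ->; apply: A_exact. Qed.

Section CleanCycles.
Variables (R : pzRingType) (A X : complex R) (E : cextension X A).
Hypothesis A_exact : exact_complex A.
Local Notation M := (cext_mid E).

Lemma cext_out_in n y : cext_out E n (cext_in E n y) = 0.
Proof. by apply/cext_exact; exists y. Qed.

(* Given a section [s] in degrees below [n], its possible values at [x] in
   degree [n] are the [e] over [x] with [d e = s (d x)]. The pairs [(x, e)] form an
   extension of [X_n] by [Z_n A], the surjectivity onto [X_n] being due to the
   exactness of [A]. *)
Lemma section_step n (s : forall k, {linear X k -> M k}) :
    Ext1_zero (X n) (cycles A n) ->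
    (forall k, k < n -> forall x, cext_out E k (s k x) = x) ->
    (forall i j, i < n -> forall x, s j (dif X i j x) = dif M i j (s i x)) ->
  exists t : {linear X n -> M n},
    [/\ forall x, cext_out E n (t x) = x
      & forall x, dif M n (n - 1) (t x) = s (n - 1) (dif X n (n - 1) x)].
Proof.
move=> ext0 sK s_dif.
(* The defect of [e] from being an admissible value; [ker psi] is the middle term of the
   extension. *)
pose psi : {linear M n -> M (n - 1)} :=
  dif M n (n - 1) \- (s (n - 1) \o (dif X n (n - 1) \o cext_out E n)).
have psi_in (z : cycles A n) : psi ((cext_in E n \o ker_in (dif A n (n - 1))) z) = 0.
  by rewrite /= cext_out_in !linear0 addr0 -cmap_dif ker_eq0 linear0.
have lt_n : n - 1 < n by lia.
have in_inj : injective (ker_lift psi_in).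
  by move=> y z /(congr1 val)/(@cext_inj _ _ _ E)/val_inj.
have out_surj : surj (cext_out E n \o ker_in psi).
  move=> x; have [e ex] := @cext_surj _ _ _ E n x.
  (* For any [e] over [x], the defect [psi e] comes from a cycle [a] of [A], which is a boundary
     [d b]; subtracting the image of [b] from [e] makes it admissible. *)
  have /cext_exact[a ae] : cext_out E (n - 1) (psi e) = 0.
    by rewrite /= linearB sK // cmap_dif subrr.
  have /(exact_complexE A_exact _ (erefl _))-/(_ n)[|b ba] :
      dif A (n - 1) (n - 1 - 1) a = 0.
  - apply: (@cext_inj _ _ _ E); rewrite cmap_dif ae linear0 /= linearB dif_dif.
    by rewrite -s_dif // dif_dif linear0 subr0.
  - by rewrite subrK.
  have eP : e - cext_in E n b \in ker_pred psi.
    apply/eqP; rewrite linearB -ae -ba cmap_dif /= cext_out_in !linear0 addr0.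
    by rewrite subrr.
  by exists (Ker eP); rewrite /= linearB cext_out_in subr0.
have in_out_exact : exact_at (ker_lift psi_in) (cext_out E n \o ker_in psi).
  move=> [e eP]; split=> [/=|[z <-]]; last exact: cext_out_in.
  move=> oe0; have /cext_exact[a ae] := oe0.
  have aP : a \in ker_pred (dif A n (n - 1)).
    apply/eqP; apply: (@cext_inj _ _ _ E); rewrite cmap_dif ae linear0.
    by have := ker_eq0 (Ker eP); rewrite /= oe0 !linear0 addr0.
  by exists (Ker aP); apply: val_inj.
have /ext_splitP[t tK] := ext0 (Extension in_inj out_surj in_out_exact).
exists (ker_in psi \o t); split=> [x|x]; first exact: tK.
have := ker_eq0 (t x); rewrite /= => /eqP; rewrite subr_eq0 => /eqP ->.
by rewrite -[X in _ = s _ (dif _ _ _ X)]tK.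
Qed.

Hypothesis A_clean : forall n, abs_clean_mod (cycles A n).

Lemma section_upto (a : int) (N : nat) :
    (forall n, FP_infty (X n)) -> (forall n, n < a -> forall x : X n, x = 0) ->
  exists s : forall k, {linear X k -> M k},
    (forall k, k < a + N%:Z -> forall x, cext_out E k (s k x) = x) /\
    (forall i j, i < a + N%:Z -> forall x, s j (dif X i j x) = dif M i j (s i x)).
Proof.
move=> FPX X0; elim: N => [|N [s [sK s_dif]]].
  exists (fun k => \0); rewrite addr0; split=> [k ka x|i j _ x].
    by rewrite (X0 k ka x) !linear0.
  by rewrite /= linear0.
set n := a + N%:Z in sK s_dif.
have [t [tK t_dif]] := section_step (A_clean (FPX n)) sK s_dif.
(* [idm] carries [t] to a variable degree [k]; the result is used only for [k = n], where it equals
   [t]. *)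
pose t' k : {linear X k -> M k} := idm (deg M) n k \o (t \o idm (deg X) k n).
pose s' k := if k == n then t' k else s k.
have s'n x : s' n x = t x by rewrite /s' eqxx /= !idm_id.
have s's k x : k <> n -> s' k x = s k x by rewrite /s'; case: eqP.
have -> : a + N.+1%:Z = n + 1 by rewrite /n; lia.
exists s'; split=> [k kn x|i j iN x].
  have [kn'|kn'] := pselect (k = n); first by subst k; rewrite s'n tK.
  by rewrite s's // sK //; lia.
have [ij|ij] := pselect (i = j + 1); last by rewrite !(dif_shape ij) linear0.
(* The target degree [j = i - 1] is below [n], so only the value of [s'] in the source degree can be
   the new one. *)
have jn : j <> n by lia.
rewrite s's //.
have [i_n|i_n] := pselect (i = n); last by rewrite s's // s_dif //; lia.
have jE : j = n - 1 by lia.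
by clear ij; subst i; rewrite s'n jE t_dif.
Qed.

Lemma cext_split_of_clean_cycles :
  bounded X -> (forall n, FP_infty (X n)) -> cext_equiv E (csplit_ext X A).
Proof.
move=> [a [b X0]] FPX; apply/cext_splitP.
(* This many steps go past [b], above which [X] is zero. *)
have [|s [sK s_dif]] := @section_upto a `|b - a|.+1 FPX.
  by move=> n na x; apply: X0; rewrite na.
have X_big k (x : X k) : ~ (k < a + `|b - a|.+1%:Z) -> x = 0.
  by move=> kN; apply: X0; apply/orP; right; lia.
have s_dif' i j x : s j (dif X i j x) = dif M i j (s i x).
  have [/s_dif//|iN] := pselect (i < a + `|b - a|.+1%:Z).
  by rewrite (X_big i x iN) !linear0.
exists (ChainMap s_dif') => n x /=.
have [/sK//|nN] := pselect (n < a + `|b - a|.+1%:Z).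
by rewrite (X_big n x nN) !linear0.
Qed.

End CleanCycles.

(** * Spheres *)

Section Spheres.
Variable R : pzRingType.
Implicit Types M N : lmodType R.

Section Sphere.
Variables (n : int) (M : lmodType R).

(** The kernel of this map is all of [M] for [k = n] and zero otherwise, so the sphere is defined
    without casting [M] along an equality of degrees. *)
Fact sphere_cut_linear k : linear (fun x : M => if k == n then 0 else x).
Proof. by move=> a x y; case: eqP; rewrite ?scaler0 ?addr0. Qed.

Fact sphere_cut_eq0 k x : lin (@sphere_cut_linear k) x = 0 -> k <> n -> x = 0.
Proof. by rewrite /=; case: eqP. Qed.

Definition sphere : complex R :=
  @Complex R (fun k => ker (lin (@sphere_cut_linear k)))
    (fun i j => \0) (fun _ _ _ _ => erefl) (fun _ _ _ _ => erefl).

Lemma sphere_eq0 k (x : sphere k) : k <> n -> x = 0.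
Proof. by move=> kn; apply: val_inj; apply: sphere_cut_eq0 (ker_eq0 x) kn. Qed.

Fact sphere_in_subproof (x : M) : lin (@sphere_cut_linear n) (idfun x) = 0.
Proof. by rewrite /= eqxx. Qed.

Definition sphere_in : {linear M -> sphere n} := ker_lift sphere_in_subproof.

Lemma sphere_in_inj : injective sphere_in.
Proof. by move=> x y /(congr1 val). Qed.

Lemma sphere_in_surj : surj sphere_in.
Proof. by move=> x; exists (val x); apply: val_inj. Qed.

Lemma cFP_infty_sphere : FP_infty M -> cFP_infty sphere.
Proof.
move=> FPM; apply: cFP_infty_of_deg => [|k].
  by exists n, n => k kn x; apply: sphere_eq0; case/orP: kn; lia.
have [kn|kn] := pselect (k = n); last first.
  by apply: FP_infty_zero => x; apply: sphere_eq0.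
by rewrite kn; apply: FP_infty_bij sphere_in_inj sphere_in_surj FPM.
Qed.

End Sphere.

Section SphereMap.
Variables (n : int) (M N : lmodType R) (f : {linear M -> N}).

Fact sphere_map_subproof k (x : sphere n M k) :
  lin (@sphere_cut_linear n N k) ((f \o ker_in _) x) = 0.
Proof.
have [kn|/(sphere_eq0 x) ->] := pselect (k = n); last by rewrite !linear0.
by subst k; apply: sphere_in_subproof.
Qed.

Definition sphere_map : chain_map (sphere n M) (sphere n N) :=
  @ChainMap R (sphere n M) (sphere n N)
    (fun k => ker_lift (@sphere_map_subproof k)) (fun _ _ _ => linear0 _).

Lemma sphere_map_in x : sphere_map n (sphere_in n M x) = sphere_in n N (f x).
Proof. exact: val_inj. Qed.

Lemma sphere_map_inj : injective f -> cinj sphere_map.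
Proof. by move=> f_inj k x y /(congr1 val)/f_inj/val_inj. Qed.

Lemma sphere_map_surj : surj f -> csurj sphere_map.
Proof.
move=> f_surj k y; have [kn|kn] := pselect (k = n); last first.
  by exists 0; rewrite linear0 (sphere_eq0 y kn).
subst k; have [y' <-] := sphere_in_surj y; have [x <-] := f_surj y'.
by exists (sphere_in n M x); rewrite sphere_map_in.
Qed.

End SphereMap.

Lemma sphere_map_exact n (L M N : lmodType R) (f : {linear L -> M})
    (g : {linear M -> N}) :
  exact_at f g -> cexact_at (sphere_map n f) (sphere_map n g).
Proof.
move=> fg k y; have [kn|kn] := pselect (k = n); last first.
  rewrite (sphere_eq0 y kn) linear0; split=> // _; exists 0; exact: linear0.
subst k; have [{}y <-] := sphere_in_surj y; rewrite sphere_map_in.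
split=> [/(congr1 val)/fg[x <-]|[x]].
  by exists (sphere_in n L x); rewrite sphere_map_in.
have [{}x <-] := sphere_in_surj x; rewrite sphere_map_in.
by move/sphere_in_inj => xy; have -> : g y = 0 by [apply/fg; exists x]; rewrite linear0.
Qed.

End Spheres.

(** * Exactness of absolutely clean complexes *)

Section TwistedSum.
Variables (R : pzRingType) (A : complex R) (n : int) (y : A n).
Hypothesis dy0 : dif A n (n - 1) y = 0.
Local Notation S := (sphere (n + 1) R^o).

(* The mapping cone of the map S^n(R) -> A picking the cycle [y]. *)
Definition twist_deg k : lmodType R := (A k * S k)%type.

Fact twist_linear i j : linear (fun z : twist_deg i =>
  (dif A i j z.1 + (ker_val z.2 : R) *: idm (deg A) n j y, 0) : twist_deg j).
Proof.
move=> a x z; congr pair; rewrite /= ?scaler0 ?addr0 //.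
by rewrite linearP scalerDl scalerDr scalerA addrACA.
Qed.

Fact twist_shape i j : i <> j + 1 -> forall z, lin (@twist_linear i j) z = 0.
Proof.
move=> ij [x r]; congr pair; rewrite /= dif_shape // add0r.
(* If [j = n], then [i] is not [n + 1], and the sphere component [r] vanishes. *)
have [jn|nj] := pselect (n = j); last by rewrite idm_neq // scaler0.
by have -> := sphere_eq0 r; rewrite ?scale0r // jn.
Qed.

Fact twist_dif_dif i j k z :
  lin (@twist_linear j k) (lin (@twist_linear i j) z) = 0.
Proof.
congr pair; rewrite /= scale0r addr0 linearD dif_dif add0r linearZ /=.
have [jn|nj] := pselect (n = j); last by rewrite idm_neq // linear0 scaler0.
subst j; rewrite idm_id; have [kn|kn] := pselect (n = k + 1).
  by have -> : k = n - 1 by [lia]; rewrite dy0 scaler0.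
by rewrite dif_shape // scaler0.
Qed.

Definition twist : complex R :=
  @Complex R twist_deg (fun i j => lin (@twist_linear i j)) twist_shape twist_dif_dif.

Fact twist_in_dif i j x :
  inl_lin (S j) (A j) (dif A i j x) = dif twist i j (inl_lin (S i) (A i) x).
Proof. by congr pair; rewrite /= scale0r addr0. Qed.

Definition twist_in : chain_map A twist :=
  @ChainMap R A twist (fun k => inl_lin (S k) (A k)) twist_in_dif.

Definition twist_out : chain_map twist S :=
  @ChainMap R twist S (fun k => outr_lin (S k) (A k)) (fun _ _ _ => erefl).

Definition twist_ext : cextension S A :=
  @CExtension R S A twist twist_in twist_out
    (fun k => @inl_lin_inj R (S k) (A k)) (fun k => @outr_lin_surj R (S k) (A k))
    (fun k => @inl_outr_exact R (S k) (A k)).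

End TwistedSum.

Lemma abs_clean_exact (R : pzRingType) (A : complex R) :
  abs_clean_complex A -> exact_complex A.
Proof.
move=> A_clean n y; split=> [dy0|[x <-]]; last exact: dif_dif.
have FPS : cFP_infty (sphere (n + 1) R^o).
  apply/cFP_infty_sphere/FP_infty_projective; first exact: fin_gen_regular.
  exact: projective_regular.
have /cext_splitP[s sK] := A_clean _ FPS (twist_ext dy0).
have := sK _ (sphere_in (n + 1) R^o 1).
(* The section sends the generator to some [(x, 1)]. The sphere has zero differential, so
   [d x + y = 0]. *)
have /(congr1 fst) := cmap_dif s n (sphere_in (n + 1) R^o 1).
rewrite linear0; case: (s (n + 1) _) => x r /= + rE; rewrite {}rE /=.
rewrite idm_id scale1r => /esym/eqP; rewrite addr_eq0 => /eqP dx.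
by exists (- x); rewrite linearN dx opprK.
Qed.

(** * Cycles of absolutely clean complexes *)

Section Cokernel.
Variables (R : pzRingType) (U V : lmodType R) (f : {linear U -> V}).

Definition im_pred : {pred V} := fun v => `[< exists u, f u = v >].

Fact im_zmod_closed : zmod_closed im_pred.
Proof.
split=> [|x y]; first by apply/asboolP; exists 0; rewrite linear0.
move=> /asboolP[u <-] /asboolP[v <-]; apply/asboolP.
by exists (u - v); rewrite linearB.
Qed.

HB.instance Definition _ := GRing.isZmodClosed.Build V im_pred im_zmod_closed.

Definition coker : Type := Quotient.quot im_pred.

HB.instance Definition _ := GRing.Zmodule.on coker.

Local Open Scope quotient_scope.

Let proj (v : V) : coker := \pi_(Quotient.quot im_pred) v.

Let proj_eq v w : proj v = proj w <-> exists u, f u = v - w.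
Proof.
split=> [/eqP|vw]; first by rewrite /proj -Quotient.idealrBE => /asboolP.
by apply/eqP; rewrite /proj -Quotient.idealrBE; apply/asboolP.
Qed.

Let projD v w : proj (v + w) = proj v + proj w.
Proof. exact: raddfD. Qed.

Let projK x : proj (repr x) = x.
Proof. exact: reprK. Qed.

Definition coker_scale (a : R) (x : coker) : coker := proj (a *: repr x).

(** The scalar action does not depend on the representative, because the image of [f] is stable
    under scalars. *)
Let projZ a v : coker_scale a (proj v) = proj (a *: v).
Proof.
apply/proj_eq; rewrite -scalerBr.
have /proj_eq[u <-] : proj (repr (proj v)) = proj v by rewrite projK.
by exists (a *: u); rewrite linearZ.
Qed.

Fact coker_scaleA a b x : coker_scale a (coker_scale b x) = coker_scale (a * b) x.
Proof. by rewrite -[x]projK !projZ scalerA. Qed.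

Fact coker_scale1 : left_id 1 coker_scale.
Proof. by move=> x; rewrite -[x]projK projZ scale1r. Qed.

Fact coker_scaleDr : right_distributive coker_scale +%R.
Proof.
by move=> a x y; rewrite -[x]projK -[y]projK -projD !projZ -projD scalerDr.
Qed.

Fact coker_scaleDl x : {morph coker_scale^~ x : a b / a + b}.
Proof. by move=> a b; rewrite -[x]projK !projZ -projD scalerDl. Qed.

HB.instance Definition _ := GRing.Zmodule_isLmodule.Build R coker
  coker_scaleA coker_scale1 coker_scaleDr coker_scaleDl.

Fact coker_proj_linear : linear proj.
Proof. by move=> a v w; rewrite projD -projZ. Qed.

Definition coker_proj : {linear V -> coker} := lin coker_proj_linear.

Lemma coker_proj_surj : surj coker_proj.
Proof. by move=> x; exists (repr x); apply: projK. Qed.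

Lemma coker_proj_exact : exact_at f coker_proj.
Proof.
move=> v; rewrite -[0](linear0 coker_proj); split=> [/proj_eq|[u uv]].
  by rewrite subr0.
by apply/proj_eq; exists u; rewrite subr0.
Qed.

End Cokernel.

(** The differential of [V] descends to the degreewise cokernels because [f] is a chain map; its
    identities are checked on representatives. *)
Lemma coker_complex (R : pzRingType) (U V : complex R) (f : chain_map U V) :
  exists (C : complex R) (p : chain_map V C), csurj p /\ cexact_at f p.
Proof.
pose p k := coker_proj (f k).
have dP i j : exists d : {linear coker (f i) -> coker (f j)},
    forall v, d (p i v) = (p j \o dif V i j) v.
  apply: lin_epi_factor => [|v]; first exact: coker_proj_surj.
  move=> /coker_proj_exact[u <-] /=; apply/coker_proj_exact.
  by exists (dif U i j u); rewrite cmap_dif.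
pose d i j := projT1 (cid (dP i j)).
have dE i j v : d i j (p i v) = p j (dif V i j v) by exact: (projT2 (cid (dP i j))).
have p_surj k : surj (p k) by apply: coker_proj_surj.
have d_shape i j : i <> j + 1 -> forall x, d i j x = 0.
  by move=> ij x; have [v <-] := p_surj i x; rewrite dE dif_shape // linear0.
have d_dif i j k x : d j k (d i j x) = 0.
  by have [v <-] := p_surj i x; rewrite !dE dif_dif linear0.
pose C := Complex d_shape d_dif.
exists C, (@ChainMap R V C p (fun i j v => esym (dE i j v))); split=> // k.
exact: coker_proj_exact.
Qed.

(** * Pushout along the inclusion of the cycles *)

Section Cycles.
Variables (R : pzRingType) (A : complex R) (n : int).
Variables (M : lmodType R) (E : extension M (cycles A n)).
Local Notation Z := (cycles A n).
Local Notation SE := (sphere n (ext_mid E)).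

(** The map [z |-> (z, - ext_in E z)], whose cokernel is the pushout; [csum SE A] has [A] as its
    first component. *)
Fact antidiagonal_linear k : linear (fun z : sphere n Z k =>
  (idm (deg A) n k (ker_val (ker_val z)), - sphere_map n (ext_in E) k z) :
    csum SE A k).
Proof.
move=> a x y; congr pair; first by rewrite linearP.
by rewrite linearP opprD -scalerN.
Qed.

Fact antidiagonal_dif i j z :
  lin (@antidiagonal_linear j) (dif (sphere n Z) i j z) =
  dif (csum SE A) i j (lin (@antidiagonal_linear i) z).
Proof.
congr pair; last first.
  by rewrite -[LHS]/(- sphere_map n (ext_in E) j 0) linear0 oppr0.
rewrite -[LHS]/(idm (deg A) n j 0) linear0 /=.
have [i_n|i_n] := pselect (n = i); last by rewrite idm_neq // linear0.
(* Elements of [Z] are cycles, so including them in [A] is compatible with the zero differential of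
   the sphere. *)
subst i; rewrite idm_id; have [jn|jn] := pselect (n = j + 1).
  by have -> : j = n - 1 by [lia]; rewrite ker_eq0.
by rewrite dif_shape.
Qed.

Definition antidiagonal : chain_map (sphere n Z) (csum SE A) :=
  ChainMap antidiagonal_dif.

(* The pushout of 0 -> S^n(Z_n A) -> S^n(E) -> S^n(M) -> 0 along the inclusion
   of S^n(Z_n A) into A. *)
Lemma pushout_extension :
  exists (F : cextension (sphere n M) A) (p : chain_map (csum SE A) (cext_mid F)),
    [/\ cexact_at antidiagonal p, csurj p,
        forall k a, p k (a, 0) = cext_in F k a
      & forall k z, cext_out F k (p k z) = sphere_map n (ext_out E) k z.2].
Proof.
have inout_exact : cexact_at (sphere_map n (ext_in E)) (sphere_map n (ext_out E)).
  by apply: sphere_map_exact; apply: ext_exact.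
have [C [p [p_surj p_exact]]] := coker_complex antidiagonal.
have in_inj : cinj (ccomp p (cinl SE A)).
  (* If [(a - b, 0)] is the antidiagonal image of [z], its second component gives [z = 0], hence
     [a = b]. *)
  move=> k a b /eqP; rewrite -subr_eq0 -linearB => /eqP /p_exact[z].
  move=> zab; have zin0 : - sphere_map n (ext_in E) k z = 0 := congr1 snd zab.
  have z0 : z = 0.
    apply: (sphere_map_inj (@ext_inj _ _ _ E)).
    by rewrite linear0; apply: oppr_inj; rewrite oppr0.
  have : 0 = a - b by have := congr1 fst zab; rewrite z0 linear0.
  by move/esym/eqP; rewrite subr_eq0 => /eqP.
have qP k : exists q : {linear C k -> sphere n M k},
    forall z, q (p k z) = (sphere_map n (ext_out E) k \o outr_lin (SE k) (A k)) z.
  apply: lin_epi_factor => // z /p_exact[w <-].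
  rewrite -[LHS]/(sphere_map n (ext_out E) k (- sphere_map n (ext_in E) k w)) linearN.
  have -> : sphere_map n (ext_out E) k (sphere_map n (ext_in E) k w) = 0.
    by apply/inout_exact; exists w.
  by rewrite oppr0.
pose q k := projT1 (cid (qP k)).
have qE k z : q k (p k z) = sphere_map n (ext_out E) k z.2.
  exact: (projT2 (cid (qP k))).
have q_dif i j x : q j (dif C i j x) = dif (sphere n M) i j (q i x).
  have [z <-] := p_surj i x; rewrite -cmap_dif qE.
  by rewrite -[LHS]/(sphere_map n (ext_out E) j 0) linear0.
have q_surj : csurj (ChainMap q_dif).
  move=> k m; have [e <-] := sphere_map_surj (@ext_surj _ _ _ E) m.
  by exists (p k (0, e)); rewrite /= qE.
have pq_exact : cexact_at (ccomp p (cinl SE A)) (ChainMap q_dif).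
  move=> k x; split=> [|[a <-]]; last by rewrite /= qE linear0.
  have [[a e] <-] := p_surj k x; rewrite /= qE.
  move=> /inout_exact[z ze].
  (* Adding the antidiagonal image of [z] to [(a, e)] cancels [e] without changing the class. *)
  exists (a + idm (deg A) n k (ker_val (ker_val z))).
  have /p_exact pz : exists w, antidiagonal k w = antidiagonal k z by exists z.
  rewrite -[RHS]addr0 -pz -linearD; congr (p k _).
  by congr pair; rewrite -[RHS]/(e - sphere_map n (ext_in E) k z) ze subrr.
by exists (CExtension in_inj q_surj pq_exact), p; split.
Qed.

(** In degree [n] the middle term of [E] embeds in the pushout. A section of the pushout has its
    values in this submodule, since they are cycles, and so yields a section of [E]. *)
Lemma ext_split_of_abs_clean :
  abs_clean_complex A -> FP_infty M -> ext_equiv E (split_ext M Z).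
Proof.
move=> A_clean FPM; apply/ext_splitP.
have [F [p [p_exact p_surj p_in p_out]]] := pushout_extension.
have /cext_splitP[s sK] := A_clean _ (cFP_infty_sphere n FPM) F.
have e_lin : linear (fun e => p n (0, sphere_in n (ext_mid E) e)).
  move=> a x y; rewrite -linearP; congr (p n _).
  by congr pair; [rewrite /= scaler0 addr0|apply: linearP].
have [||h hE] := @lin_mono_factor R _ _ _ (lin e_lin) (s n \o sphere_in n M).
- move=> x y /eqP; rewrite -subr_eq0 -linearB => /eqP /p_exact[z zxy].
  have z0 : z = 0.
    apply: val_inj; apply: val_inj.
    by have := congr1 fst zxy; rewrite /= idm_id.
  have /(congr1 val)/esym/eqP : 0 = sphere_in n (ext_mid E) (x - y).
    by have := congr1 snd zxy; rewrite z0 linear0.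
  by rewrite /= subr_eq0 => /eqP.
- move=> m /=; have [[a e]] := p_surj n (s n (sphere_in n M m)).
  have [{}e <-] := sphere_in_surj e => ae.
  (* The differential of the class of [(a, e)] is the image of [d a]; it vanishes because the sphere
     has zero differential. *)
  have aP : a \in ker_pred (dif A n (n - 1)).
    apply/eqP; apply: (@cext_inj _ _ _ F); rewrite linear0 -p_in.
    have := cmap_dif s (n - 1) (sphere_in n M m); rewrite -ae -cmap_dif => sE.
    exact: etrans (esym sE) (linear0 _).
  (* Subtracting the antidiagonal image of the cycle [a] moves it from the first component to the
     second. *)
  exists (e + ext_in E (Ker aP)); rewrite -ae.
  have /p_exact pz : exists w, antidiagonal n w =
      antidiagonal n (sphere_in n Z (Ker aP)) by exists (sphere_in n Z (Ker aP)).
  rewrite -[RHS]subr0 -pz -linearB; congr (p n _); congr pair.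
    by rewrite /= idm_id subrr.
  rewrite -[RHS]/(sphere_in n _ e - - sphere_map n (ext_in E) n (sphere_in n Z (Ker aP))).
  by rewrite opprK sphere_map_in -linearD.
exists h => m; apply: (@sphere_in_inj R n M).
by rewrite -[RHS]sK -[s n _](hE m) p_out sphere_map_in.
Qed.

End Cycles.

Theorem proposition2p6 (R : pzRingType) (A : complex R) :
  abs_clean_complex A <->
  exact_complex A /\ forall n : int, abs_clean_mod (cycles A n).
Proof.
split=> [A_clean|[A_exact Z_clean] X FPX E].
  split=> [|n M FPM E]; first exact: abs_clean_exact.
  exact: ext_split_of_abs_clean.
apply: cext_split_of_clean_cycles => //; first exact: cFP_infty_bounded.
by move=> n; apply: cFP_infty_deg.
Qed.
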